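(* Let $\mathcal{A}$ be a unital associative algebra over $\mathbb{C}$ graded by a finite abelian group $G$, with dual group $\widehat G=\mathrm{Hom}(G,\mathbb{C}^* )$ acting on $\mathcal{A}$ by automorphisms. Let $M$ be a simple $\mathcal{A}$-module, and let $\sigma\in\widehat G$. (i) Any thin covering $\{M_g\mid g\in G\}$ of $M$ is also a thin covering of $M^\sigma$. (ii) Let $\{M_g\mid g\in G\}$ be a thin covering of $M$, and let $\{M_g^\sigma\mid g\in G\}$ be the same covering, regarded as a covering of $M^\sigma$. Then the following graded-simple $\mathcal{A}$-modules are naturally isomorphic: $$\bigoplus_{g\in G}M_g^\sigma\cong\Big(\bigoplus_{g\in G}M_g\Big)^\sigma.$$ (iii) If $P$ is a $G$-graded $\mathcal{A}$-module, then $P^\sigma\cong P$ for all $\sigma\in\widehat G$.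
   Context: Modules are left modules. An element $\sigma\in\widehat G$ is interpreted as the finite-order automorphism of $\mathcal{A}$ given by $\sigma(a)=\sigma(g)a$ for $a\in\mathcal{A}_g$. If $(M,\rho)$ is an $\mathcal{A}$-module with action $\rho$, then $M^\sigma$ is the $\mathcal{A}$-module on the space $M$ with action $\rho\circ\sigma$. A ($G$-)covering of $M$ is a family of subspaces $\{M_g\mid g\in G\}$ with $\sum_gM_g=M$ and $\mathcal{A}_gM_h\subseteq M_{g+h}$ for all $g,h\in G$. It is thin if whenever $\{N_g\}$ is a covering of $M$ with $N_g\subseteq M_g$ for all $g$, then $N_g=M_g$ for all $g$. For a thin covering of a simple module, the external direct sum $\bigoplus_{g\in G}M_g$ is a $G$-graded module whose degree-$g$ component is $M_g$, with $\mathcal{A}_g$ mapping the component $M_h$ to the component $M_{g+h}$ by the action on $M$; it is graded-simple (no proper nonzero graded submodules). *)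

(* Defs.v *)
From HB Require Import structures.
From mathcomp Require Import all_boot all_algebra.
From mathcomp Require Import boolp classical_sets reals complex.

Set Implicit Arguments.
Unset Strict Implicit.
Unset Printing Implicit Defensive.

Import GRing.Theory.

Local Open Scope ring_scope.
Local Open Scope classical_set_scope.
Local Open Scope complex_scope.

(* The dual group Hom(G, C^* ) of an additively written group G. *)
Record dual (R : realType) (G : finZmodType) := Dual {
  dual_fun :> G -> R[i];
  dual_neq0 : forall g, dual_fun g != 0;
  dualD : forall g h, dual_fun (g + h) = dual_fun g * dual_fun h
}.

Definition submodule (K : pzRingType) (V : lmodType K) (S : set V) : Prop :=
  S 0 /\ forall (a : K) (u v : V), S u -> S v -> S (a *: u + v).

(* C-subspaces of a left module over a unital C-algebra A: the scalar c acts
   as the element c%:A of A. *)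
Definition subspace (R : realType) (A : algType R[i]) (M : lmodType A)
    (S : set M) : Prop :=
  S 0 /\ forall (c : R[i]) (u v : M), S u -> S v -> S (c%:A *: u + v).

Definition sum_full (G : finZmodType) (V : zmodType) (F : G -> set V) : Prop :=
  forall v, exists x : {ffun G -> V},
    (forall g, F g (x g)) /\ \sum_g x g = v.

Definition sum_direct (G : finZmodType) (V : zmodType) (F : G -> set V) :
    Prop :=
  forall v, exists! x : {ffun G -> V},
    (forall g, F g (x g)) /\ \sum_g x g = v.

Record algebra_grading (R : realType) (G : finZmodType) (A : algType R[i]) :=
  AlgebraGrading {
    homog :> G -> set A;
    homog_subspace : forall g, submodule (homog g);
    homog_direct : sum_direct homog;
    homogM : forall g h a b, homog g a -> homog h b -> homog (g + h) (a * b)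
  }.

Section Grading.
Context (R : realType) (G : finZmodType) (A : algType R[i]).
Context (gr : algebra_grading G A).
Implicit Types (a b : A) (g h k : G).

Definition hcomps a : {ffun G -> A} := sval (cid (homog_direct gr a)).
Definition hcomp g a : A := hcomps a g.

Lemma hcompP g a : gr g (hcomp g a).
Proof. by rewrite /hcomp /hcomps; case: cid => x /= [[]]. Qed.

Lemma hcomp_sum a : \sum_g hcomp g a = a.
Proof. by rewrite /hcomp /hcomps; case: cid => x /= [[]]. Qed.

Lemma hcomp_uniq (x : G -> A) a :
  (forall g, gr g (x g)) -> \sum_g x g = a -> forall g, hcomp g a = x g.
Proof.
move=> xP xa g; rewrite /hcomp /hcomps; case: cid => y /= [_ yu].
rewrite (yu [ffun h => x h]) ?ffunE//; split; first by move=> h; rewrite ffunE.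
by rewrite -xa; apply: eq_bigr => h _; rewrite ffunE.
Qed.

Lemma homog0 g : gr g 0.
Proof. by case: (homog_subspace gr g). Qed.

Lemma homogZD g (c : R[i]) a b : gr g a -> gr g b -> gr g (c *: a + b).
Proof. by case: (homog_subspace gr g) => _; apply. Qed.

Lemma homogD g a b : gr g a -> gr g b -> gr g (a + b).
Proof. by move=> ga gb; rewrite -[a]scale1r; apply: homogZD. Qed.

Lemma homog_sum g (I : finType) (P : pred I) (x : I -> A) :
  (forall i, P i -> gr g (x i)) -> gr g (\sum_(i | P i) x i).
Proof. by move=> xP; apply: big_ind => //; [exact: homog0|exact: homogD]. Qed.

Lemma hcomp_linear g : linear (hcomp g).
Proof.
move=> c a b; apply: (@hcomp_uniq (fun h => c *: hcomp h a + hcomp h b)).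
  by move=> h; apply: homogZD; apply: hcompP.
by rewrite big_split/= -scaler_sumr !hcomp_sum.
Qed.

HB.instance Definition _ g :=
  GRing.isLinear.Build R[i] A A _ (hcomp g) (hcomp_linear g).

Lemma hcomp_homog g h a : gr h a -> hcomp g a = if g == h then a else 0.
Proof.
move=> ha; apply: (@hcomp_uniq (fun k => if k == h then a else 0)).
  by move=> k; case: eqP => [->//|_]; apply: homog0.
by rewrite -big_mkcond big_pred1_eq.
Qed.

Lemma hcompM k a b : hcomp k (a * b) = \sum_g hcomp g a * hcomp (k - g) b.
Proof.
apply: (@hcomp_uniq (fun k => \sum_g hcomp g a * hcomp (k - g) b)).
  move=> h; apply: homog_sum => g _.
  by rewrite -{1}[h](subrKC g); apply: homogM; apply: hcompP.
rewrite exchange_big/= -[in RHS](hcomp_sum a) mulr_suml.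
apply: eq_bigr => g _; rewrite -mulr_sumr; congr (_ * _).
rewrite -[RHS]hcomp_sum (reindex_onto (fun h => h + g) (fun h => h - g))/=.
  by apply: eq_big => [h|h _]; rewrite addrK// eqxx.
by move=> h _; rewrite subrK.
Qed.

Lemma homog1 : gr 0 1.
Proof.
have e0 a g : gr g a -> a * hcomp 0 1 = a.
  move=> ga.
  have := @hcomp_uniq (fun h => a * hcomp (h - g) 1) a.
  move=> /(_ _ _ g); rewrite subrr => <-.
  - by rewrite (hcomp_homog _ ga) eqxx.
  - by move=> h; rewrite -{1}[h](subrKC g); apply: homogM => //; apply: hcompP.
  rewrite -mulr_sumr (reindex_onto (fun h => h + g) (fun h => h - g))/=.
    rewrite (eq_big predT (fun h => hcomp h 1)) ?hcomp_sum ?mulr1// => h.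
      by rewrite addrK eqxx.
    by rewrite addrK.
  by move=> h _; rewrite subrK.
suff -> : 1 = hcomp 0 1 :> A by apply: hcompP.
rewrite -[RHS]mul1r -[X in X * _]hcomp_sum mulr_suml -[LHS]hcomp_sum.
by apply: eq_bigr => g _; rewrite (e0 _ g)//; apply: hcompP.
Qed.

(* The automorphism of A attached to s: it multiplies gr g by s g. *)
Definition dual_act (s : dual R G) a : A := \sum_g s g *: hcomp g a.

Lemma dual1 (s : dual R G) : s 0 = 1.
Proof.
by apply: (mulfI (dual_neq0 s 0)); rewrite -dualD addr0 mulr1.
Qed.

Lemma dual_act_homog (s : dual R G) g a : gr g a -> dual_act s a = s g *: a.
Proof.
move=> ga; rewrite /dual_act (bigD1 g)//= (hcomp_homog _ ga) eqxx.
rewrite big1 ?addr0// => h hg.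
by rewrite (hcomp_homog _ ga) (negPf hg) scaler0.
Qed.

Lemma dual_act_linear (s : dual R G) : linear (dual_act s).
Proof.
move=> c a b; rewrite /dual_act scaler_sumr -big_split/=.
apply: eq_bigr => g _; rewrite linearP/= scalerDr; congr (_ + _).
by rewrite !scalerA mulrC.
Qed.

HB.instance Definition _ (s : dual R G) :=
  GRing.isLinear.Build R[i] A A _ (dual_act s) (dual_act_linear s).

Lemma hcomp_dual_act (s : dual R G) g a :
  hcomp g (dual_act s a) = s g *: hcomp g a.
Proof.
rewrite /dual_act raddf_sum/= (bigD1 g)//= linearZ/=.
rewrite (hcomp_homog _ (hcompP g a)) eqxx big1 ?addr0// => h hg.
rewrite linearZ/= (hcomp_homog _ (hcompP h a)).
by rewrite eq_sym (negPf hg) scaler0.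
Qed.

Lemma dual_act_monoid (s : dual R G) : monoid_morphism (dual_act s).
Proof.
split; first by rewrite (dual_act_homog _ homog1) dual1 scale1r.
move=> a b; rewrite -[LHS]hcomp_sum -[RHS]hcomp_sum; apply: eq_bigr => k _.
rewrite hcomp_dual_act !hcompM scaler_sumr; apply: eq_bigr => g _.
rewrite !hcomp_dual_act -scalerAl -scalerAr scalerA -dualD.
by rewrite subrKC.
Qed.

HB.instance Definition _ (s : dual R G) :=
  GRing.isMonoidMorphism.Build A A (dual_act s) (dual_act_monoid s).

Lemma dual_act_bij (s : dual R G) : bijective (dual_act s).
Proof.
exists (fun a => \sum_g (s g)^-1 *: hcomp g a) => a.
  rewrite -[RHS]hcomp_sum; apply: eq_bigr => g _.
  by rewrite hcomp_dual_act scalerA mulVf ?scale1r ?dual_neq0.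
rewrite raddf_sum/= -[RHS]hcomp_sum; apply: eq_bigr => g _.
rewrite linearZ/= (dual_act_homog _ (hcompP g a)).
by rewrite scalerA mulVf ?scale1r ?dual_neq0.
Qed.

End Grading.

(* M^s: the additive group M, on which a acts as dual_act gr s a does on M. *)
Definition twist (R : realType) (G : finZmodType) (A : algType R[i])
  (gr : algebra_grading G A) (s : dual R G) (M : lmodType A) : Type := M.

Section Twist.
Context (R : realType) (G : finZmodType) (A : algType R[i]).
Context (gr : algebra_grading G A) (s : dual R G) (M : lmodType A).

HB.instance Definition _ := GRing.Zmodule.on (twist gr s M).

Definition twist_scale (a : A) (v : twist gr s M) : twist gr s M :=
  dual_act gr s a *: (v : M).

Fact twist_scaleA a b v :
  twist_scale a (twist_scale b v) = twist_scale (a * b) v.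
Proof. by rewrite /twist_scale scalerA rmorphM. Qed.

Fact twist_scale1 : left_id 1 twist_scale.
Proof. by move=> v; rewrite /twist_scale rmorph1 scale1r. Qed.

Fact twist_scaleDr : right_distributive twist_scale +%R.
Proof. by move=> a u v; rewrite /twist_scale scalerDr. Qed.

Fact twist_scaleDl v : {morph twist_scale^~ v : a b / a + b}.
Proof. by move=> a b; rewrite /twist_scale raddfD scalerDl. Qed.

HB.instance Definition _ := GRing.Zmodule_isLmodule.Build A (twist gr s M)
  twist_scaleA twist_scale1 twist_scaleDr twist_scaleDl.

Lemma twist_scaleE (a : A) (v : twist gr s M) :
  a *: v = dual_act gr s a *: (v : M) :> M.
Proof. by []. Qed.

End Twist.

Definition simple_module (A : pzRingType) (M : lmodType A) : Prop :=
  (exists v : M, v != 0) /\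
  forall S : set M, submodule S -> S = [set 0] \/ S = setT.

Section GradedModules.
Context (R : realType) (G : finZmodType) (A : algType R[i]).
Context (gr : algebra_grading G A).

Definition is_covering (M : lmodType A) (F : G -> set M) : Prop :=
  [/\ forall g, subspace (F g),
      sum_full F
    & forall g h a m, gr g a -> F h m -> F (g + h) (a *: m)].

Definition thin_covering (M : lmodType A) (F : G -> set M) : Prop :=
  is_covering F /\
  forall N : G -> set M, is_covering N -> (forall g, N g `<=` F g) ->
    forall g, N g = F g.

Definition module_grading (P : lmodType A) (F : G -> set P) : Prop :=
  [/\ forall g, subspace (F g),
      sum_direct F
    & forall g h a p, gr g a -> F h p -> F (g + h) (a *: p)].

Definition graded_submodule (P : lmodType A) (F : G -> set P) (N : set P) :
    Prop :=
  submodule N /\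
  forall p, N p -> exists x : {ffun G -> P},
    (forall g, F g (x g) /\ N (x g)) /\ \sum_g x g = p.

Definition graded_simple (P : lmodType A) (F : G -> set P) : Prop :=
  [/\ module_grading F,
      exists p : P, p != 0
    & forall N : set P, graded_submodule F N -> N = [set 0] \/ N = setT].

Definition graded_iso (P Q : lmodType A) (FP : G -> set P) (FQ : G -> set Q)
    (f : {linear P -> Q}) : Prop :=
  bijective f /\ forall g, f @` FP g = FQ g.

Record covering (M : lmodType A) := Covering {
  cov :> G -> set M;
  covP : is_covering cov
}.

Lemma subspaceD (M : lmodType A) (S : set M) u v :
  subspace S -> S u -> S v -> S (u + v).
Proof.
by case=> _ SP Su Sv; have := SP 1 u v Su Sv; rewrite !scale1r.
Qed.

Lemma subspace_opp (M : lmodType A) (S : set M) u :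
  subspace S -> S u -> S (- u).
Proof.
case=> S0 SP Su; have := SP (- 1) u 0 Su S0.
by rewrite scaleN1r scaleN1r addr0.
Qed.

Lemma is_covering_twist (s : dual R G) (M : lmodType A) (F : G -> set M) :
  is_covering F -> @is_covering (twist gr s M) F.
Proof.
case=> Fs Ff FM; split=> //.
- move=> g; case: (Fs g) => F0 FP; split=> // c u v Fu Fv.
  have -> : c%:A *: u + v = c%:A *: (u : M) + v :> M.
    by rewrite twist_scaleE linearZ/= rmorph1.
  exact: FP.
- move=> g h a m ga Fm; rewrite twist_scaleE (dual_act_homog _ ga).
  rewrite -mulr_algl -scalerA.
  have [F0 FP] := Fs (g + h).
  by rewrite -[_ *: _]addr0; apply: FP => //; apply: FM.
Qed.

(* The family M_g^s: the same subspaces, regarded as a covering of M^s. *)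
Definition covering_twist (s : dual R G) (M : lmodType A) (F : covering M) :
    covering (twist gr s M) :=
  @Covering (twist gr s M) F (is_covering_twist s (covP F)).

End GradedModules.

Definition dsum_pred (R : realType) (G : finZmodType) (A : algType R[i])
    (gr : algebra_grading G A) (M : lmodType A) (F : covering gr M) :
    {pred {ffun G -> M}} :=
  fun x => `[< forall g, F g (x g) >].

(* The external direct sum of the subspaces F g of M. *)
Record dsum (R : realType) (G : finZmodType) (A : algType R[i])
    (gr : algebra_grading G A) (M : lmodType A) (F : covering gr M) := Dsum {
  dsum_val :> {ffun G -> M};
  dsum_valP : dsum_val \in dsum_pred F
}.

Section DirectSum.
Context (R : realType) (G : finZmodType) (A : algType R[i]).
Context (gr : algebra_grading G A) (M : lmodType A) (F : covering gr M).

HB.instance Definition _ := [isSub of dsum F for @dsum_val R G A gr M F].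
HB.instance Definition _ := [Choice of dsum F by <:].

Fact dsum_zmod_closed : zmod_closed (dsum_pred F).
Proof.
have [Fs _ _] := covP F.
split; first by apply/asboolP => g; rewrite ffunE; case: (Fs g).
move=> x y /asboolP xP /asboolP yP; apply/asboolP => g; rewrite !ffunE.
by apply: (subspaceD (Fs g)) => //; apply: subspace_opp.
Qed.

HB.instance Definition _ :=
  GRing.isZmodClosed.Build _ (dsum_pred F) dsum_zmod_closed.
HB.instance Definition _ := [SubChoice_isSubZmodule of dsum F by <:].

Lemma dsumP (x : dsum F) g : F g (x g).
Proof. by case: x => x /= /asboolP. Qed.

Fact dsum_scale_subproof (a : A) (x : dsum F) :
  [ffun k => \sum_g hcomp gr g a *: x (k - g)] \in dsum_pred F.
Proof.
have [Fs _ FM] := covP F.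
apply/asboolP => k; rewrite ffunE; apply: big_ind.
- by case: (Fs k).
- by move=> u v; apply: subspaceD.
- move=> g _; rewrite -{1}[k](subrKC g).
  by apply: FM; [exact: hcompP|exact: dsumP].
Qed.

(* a in gr g sends the component of index h to that of index g + h. *)
Definition dsum_scale (a : A) (x : dsum F) : dsum F :=
  Dsum (dsum_scale_subproof a x).

Lemma dsum_scaleE a x k :
  dsum_scale a x k = \sum_g hcomp gr g a *: x (k - g).
Proof. by rewrite ffunE. Qed.

Lemma dsum_ext (x y : dsum F) : (forall g, x g = y g) -> x = y.
Proof. by move=> xy; apply/val_inj/ffunP. Qed.

Lemma dsum_addE (x y : dsum F) g : (x + y) g = x g + y g.
Proof. by rewrite -[dsum_val (x + y)]/(val (x + y)) raddfD ffunE. Qed.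

Fact dsum_scaleA a b x : dsum_scale a (dsum_scale b x) = dsum_scale (a * b) x.
Proof.
apply: dsum_ext => k; rewrite !dsum_scaleE.
under eq_bigr => g _ do rewrite dsum_scaleE scaler_sumr.
under [RHS]eq_bigr => g _ do rewrite hcompM scaler_suml.
rewrite [RHS]exchange_big/=; apply: eq_bigr => g _.
rewrite [RHS](reindex_onto (fun h => h + g) (fun h => h - g))/=; last first.
  by move=> h _; rewrite subrK.
apply: eq_big => [h|h _]; first by rewrite addrK eqxx.
by rewrite addrK scalerA opprD addrA addrAC.
Qed.

Fact dsum_scale1 : left_id 1 dsum_scale.
Proof.
move=> x; apply: dsum_ext => k; rewrite dsum_scaleE (bigD1 0)//=.
rewrite (hcomp_homog _ (homog1 gr)) eqxx scale1r subr0 big1 ?addr0// => g g0.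
by rewrite (hcomp_homog _ (homog1 gr)) (negPf g0) scale0r.
Qed.

Fact dsum_scaleDr : right_distributive dsum_scale +%R.
Proof.
move=> a x y; apply: dsum_ext => k; rewrite dsum_addE !dsum_scaleE -big_split.
by apply: eq_bigr => g _; rewrite dsum_addE scalerDr.
Qed.

Fact dsum_scaleDl x : {morph dsum_scale^~ x : a b / a + b}.
Proof.
move=> a b; apply: dsum_ext => k; rewrite dsum_addE !dsum_scaleE -big_split.
by apply: eq_bigr => g _; rewrite raddfD scalerDl.
Qed.

HB.instance Definition _ := GRing.Zmodule_isLmodule.Build A (dsum F)
  dsum_scaleA dsum_scale1 dsum_scaleDr dsum_scaleDl.

Definition dsum_grading (g : G) : set (dsum F) :=
  [set x | forall h, h != g -> x h = 0].

End DirectSum.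

Arguments dsum_grading {R G A gr M} F g _.

(* Main.v *)
Require Import Defs.
From HB Require Import structures.
From mathcomp Require Import all_boot all_algebra.
From mathcomp Require Import boolp classical_sets reals complex.

Set Implicit Arguments.
Unset Strict Implicit.
Unset Printing Implicit Defensive.

Import GRing.Theory.

Local Open Scope ring_scope.
Local Open Scope classical_set_scope.
Local Open Scope complex_scope.


(** A homogeneous element [a] of degree [g] acts on the twist of [M] by [s] as
    [s g *: a] acts on [M], where [s g] is nonzero, and the automorphism
    attached to [s] is onto. So passing to the twist changes neither the
    coverings of a module nor its submodules, and with them thinness,
    simplicity and graded simplicity are preserved as well; this is (i).

    For (ii), both modules consist of the same families of vectors, and in
    both of them [a] of degree [g] moves the entry at [h] to [g + h] and
    multiplies it by [s g *: a]; the isomorphism is the identity on entries.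
    What needs an argument is that the direct sum of a thin covering [F] of a
    simple module is graded-simple ([dsum_graded_simple]). Adding up the
    entries is a homomorphism from the direct sum to the simple module. If it
    kills a graded submodule [N] then [N] is zero, because it is injective on
    homogeneous elements. Otherwise it maps [N] onto the module, hence the
    homogeneous layers of [N] form a covering contained in [F]; they are equal
    to [F] by thinness, so [N] is everything.

    For (iii), the isomorphism from the twist of [P] to [P] divides the
    component of degree [g] by [s g] ([weighted_sum_twist_linear]); it is one
    of the maps that multiply each component by a scalar, and these compose by
    multiplying the scalars. *)

(** * Subspaces *)

Section Subspaces.
Context (R : realType) (A : algType R[i]) (M : lmodType A).

Lemma scale_algA (c d : R[i]) (v : M) :
  c%:A *: (d%:A *: v) = (c * d)%:A *: v.
Proof. by rewrite scalerA mulr_algl scalerA. Qed.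

Lemma subspace_scale (S : set M) (c : R[i]) u :
  subspace S -> S u -> S (c%:A *: u).
Proof. by case=> S0 SP Su; rewrite -[_ *: u]addr0; apply: SP. Qed.

Lemma subspace_sum (S : set M) (I : finType) (x : I -> M) :
  subspace S -> (forall i, S (x i)) -> S (\sum_i x i).
Proof.
move=> Ss Sx; apply: big_ind => //; first by case: Ss.
by move=> u v; apply: subspaceD.
Qed.

End Subspaces.

(** * Twisting by a character *)

Section TwistLemmas.
Context (R : realType) (G : finZmodType) (A : algType R[i]).
Context (gr : algebra_grading G A) (s : dual R G) (M : lmodType A).

Lemma twist_scale_homog g (a : A) (v : twist gr s M) :
  gr g a -> a *: v = (s g)%:A *: (a *: (v : M)) :> M.
Proof.
by move=> ga; rewrite twist_scaleE (dual_act_homog s ga) scalerA mulr_algl.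
Qed.

Lemma twist_scale_alg (c : R[i]) (v : twist gr s M) :
  c%:A *: v = c%:A *: (v : M) :> M.
Proof. by rewrite twist_scaleE linearZ/= rmorph1. Qed.

(** The automorphism of the algebra attached to a character is onto, so a
    module and its twist have the same submodules. *)
Lemma submodule_twist (S : set M) :
  @submodule A (twist gr s M) S <-> submodule S.
Proof.
split=> -[S0 SP]; split=> // a u v Su Sv; last exact: SP.
have [t _ tK] := dual_act_bij gr s.
by rewrite -(tK a); apply: (SP (t a)).
Qed.

Lemma simple_twist : simple_module M -> simple_module (twist gr s M).
Proof. by case=> M0 Ms; split=> // S /submodule_twist; apply: Ms. Qed.

(** A homogeneous element acts on the twist through a nonzero multiple of
    itself, so it moves subspaces in the same way on both modules. *)
Lemma is_covering_untwist (F : G -> set M) :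
  @is_covering R G A gr (twist gr s M) F -> is_covering gr F.
Proof.
case=> Fs Ff FM.
have Fs' g : @subspace R A M (F g).
  have [F0 FP] := Fs g; split=> // c u v Fu Fv.
  by have := FP c u v Fu Fv; rewrite -twist_scale_alg.
split=> // g h a m ga Fm.
have /(subspace_scale (s g)^-1 (Fs' _)) := FM g h a m ga Fm.
by rewrite (twist_scale_homog _ ga) scale_algA mulVf ?dual_neq0// !scale1r.
Qed.

Lemma thin_covering_twist (F : G -> set M) :
  thin_covering gr F -> @thin_covering R G A gr (twist gr s M) F.
Proof.
case=> Fc Ft; split; first exact: is_covering_twist.
by move=> N /is_covering_untwist; apply: Ft.
Qed.

Lemma module_grading_twist (F : G -> set M) :
  module_grading gr F -> @module_grading R G A gr (twist gr s M) F.
Proof.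
case=> Fs Fd FM; split=> //.
  move=> g; have [F0 FP] := Fs g; split=> // c u v Fu Fv.
  by have := FP c u v Fu Fv; rewrite -twist_scale_alg.
move=> g h a p ga Fp; rewrite (twist_scale_homog _ ga).
by apply: (subspace_scale (s g) (Fs _)); apply: FM.
Qed.

Lemma graded_simple_twist (F : G -> set M) :
  graded_simple gr F -> @graded_simple R G A gr (twist gr s M) F.
Proof.
case=> Fm M0 Fs; split=> //; first exact: module_grading_twist.
by move=> N [/submodule_twist Ns Nd]; apply: Fs.
Qed.

End TwistLemmas.

(** * The external direct sum of a thin covering *)

Section DirectSumSimple.
Context (R : realType) (G : finZmodType) (A : algType R[i]).
Context (gr : algebra_grading G A) (M : lmodType A) (F : covering gr M).
Implicit Types (x y : dsum F) (N : set (dsum F)).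

Lemma dsum_0E g : (0 : dsum F) g = 0.
Proof. by rewrite -[dsum_val 0]/(val (0 : dsum F)) raddf0 ffunE. Qed.

Lemma dsum_sumE (I : finType) (y : I -> dsum F) g :
  (\sum_i y i) g = \sum_i y i g.
Proof.
by elim/big_rec2: _ => [|i u v _ <-]; rewrite ?dsum_0E// dsum_addE.
Qed.

Lemma dsum_scale_homog g (a : A) x k : gr g a -> (a *: x) k = a *: x (k - g).
Proof.
move=> ga; rewrite dsum_scaleE (bigD1 g)//= (hcomp_homog _ ga) eqxx.
rewrite big1 ?addr0// => h hg.
by rewrite (hcomp_homog _ ga) (negPf hg) scale0r.
Qed.

Lemma dsum_scale_alg (c : R[i]) x k : (c%:A *: x) k = c%:A *: x k.
Proof.
have c0 : gr 0 (c%:A).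
  by rewrite -[c%:A]addr0; apply: homogZD; [apply: homog1|apply: homog0].
by rewrite (dsum_scale_homog _ _ c0) subr0.
Qed.

Fact dsum_comp_subproof g x :
  [ffun h => if h == g then x h else 0] \in dsum_pred F.
Proof.
apply/asboolP => h; rewrite ffunE; case: eqP => _; first exact: dsumP.
by have [/(_ h)[]] := covP F.
Qed.

Definition dsum_comp g x : dsum F := Dsum (dsum_comp_subproof g x).

Lemma dsum_compE g x h : dsum_comp g x h = if h == g then x h else 0.
Proof. by rewrite ffunE. Qed.

Lemma dsum_comp_homog g x : dsum_grading F g (dsum_comp g x).
Proof. by move=> h /negPf hg; rewrite dsum_compE hg. Qed.

Lemma dsum_comp_sum x : \sum_g dsum_comp g x = x.
Proof.
apply: dsum_ext => h; rewrite dsum_sumE (bigD1 h)//= dsum_compE eqxx.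
rewrite big1 ?addr0// => g gh.
by rewrite dsum_compE eq_sym (negPf gh).
Qed.

Lemma dsum_homog_ext g x y :
  dsum_grading F g x -> dsum_grading F g y -> x g = y g -> x = y.
Proof.
move=> xg yg xy; apply: dsum_ext => h.
by have [->//|hg] := eqVneq h g; rewrite xg// yg.
Qed.

Lemma dsum_comp_uniq (y : G -> dsum F) :
  (forall g, dsum_grading F g (y g)) ->
  forall g, dsum_comp g (\sum_h y h) = y g.
Proof.
move=> yP g; apply: (@dsum_homog_ext g) => //; first exact: dsum_comp_homog.
rewrite dsum_compE eqxx dsum_sumE (bigD1 g)//= big1 ?addr0// => h hg.
by rewrite yP// eq_sym.
Qed.

Lemma dsum_module_grading : module_grading gr (dsum_grading F).
Proof.
split.
- move=> g; split; first by move=> h _; rewrite dsum_0E.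
  move=> c u v ug vg h hg.
  by rewrite dsum_addE dsum_scale_alg ug// vg// scaler0 addr0.
- move=> x; exists [ffun g => dsum_comp g x]; split.
    split=> [g|]; first by rewrite ffunE; apply: dsum_comp_homog.
    by under eq_bigr do rewrite ffunE; rewrite dsum_comp_sum.
  move=> y [yP <-]; apply/ffunP => g.
  by rewrite ffunE dsum_comp_uniq.
- move=> g h a x ga xh k kgh; rewrite (dsum_scale_homog _ _ ga) xh ?scaler0//.
  by apply: contra kgh => /eqP <-; rewrite subrKC.
Qed.

Definition dsum_total x : M := \sum_g x g.

(** The total map onto the covered module is a module homomorphism, although
    it forgets the grading: it is what turns graded submodules of the direct
    sum into submodules of the covered module. *)
Lemma dsum_total_linear : linear dsum_total.
Proof.
move=> a x y; rewrite /dsum_total.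
under eq_bigr do rewrite dsum_addE dsum_scaleE.
rewrite big_split/=; congr (_ + _).
rewrite exchange_big/= -[in RHS](hcomp_sum gr a) scaler_suml.
apply: eq_bigr => g _; rewrite scaler_sumr.
rewrite (reindex_onto (fun h => h + g) (fun h => h - g))/=.
  by apply: eq_big => [h|h _]; rewrite addrK// eqxx.
by move=> h _; rewrite subrK.
Qed.

Lemma dsum_total_homog g x : dsum_grading F g x -> dsum_total x = x g.
Proof.
by move=> xg; rewrite /dsum_total (bigD1 g)//= big1 ?addr0//.
Qed.

Lemma dsum_total_image_submodule N :
  submodule N -> submodule (dsum_total @` N).
Proof.
case=> N0 NP; split.
  by exists 0 => //; rewrite /dsum_total big1// => g _; rewrite dsum_0E.
move=> a _ _ [x Nx <-] [y Ny <-]; exists (a *: x + y); first exact: NP.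
exact: dsum_total_linear.
Qed.

Lemma graded_submodule_comp N g x :
  graded_submodule (dsum_grading F) N -> N x -> N (dsum_comp g x).
Proof.
case=> _ Nd /Nd[y [yP <-]].
by rewrite dsum_comp_uniq => [|h]; [case: (yP g)|case: (yP h)].
Qed.

Definition dsum_layer N (g : G) : set M :=
  [set x g | x in [set x | N x /\ dsum_grading F g x]].

(** Fullness is the only condition that does not pass from [N] to its layers
    for free; it says that [N] maps onto the covered module. *)
Lemma dsum_layer_covering N :
  graded_submodule (dsum_grading F) N -> dsum_total @` N = setT ->
  is_covering gr (dsum_layer N).
Proof.
move=> Ng NT; have [[N0 NP] _] := Ng; have [Ds _ DM] := dsum_module_grading.
split.
- move=> g; split.
    by exists 0; rewrite ?dsum_0E//; split=> //; case: (Ds g).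
  move=> c _ _ [x [Nx xg] <-] [y [Ny yg] <-].
  exists (c%:A *: x + y); last by rewrite dsum_addE dsum_scale_alg.
  by split; [apply: NP|case: (Ds g) => _; apply].
- move=> m; have [x Nx <-] : (dsum_total @` N) m by rewrite NT.
  exists [ffun g => x g]; split=> [g|]; last first.
    by apply: eq_bigr => g _; rewrite ffunE.
  rewrite ffunE; exists (dsum_comp g x); last by rewrite dsum_compE eqxx.
  by split; [apply: graded_submodule_comp|apply: dsum_comp_homog].
- move=> g h a _ ga [x [Nx xh] <-]; exists (a *: x).
    by split; [rewrite -[_ *: x]addr0; apply: NP|apply: DM].
  by rewrite (dsum_scale_homog _ _ ga) addrC addKr.
Qed.

(** If the image of a graded submodule [N] in the simple module is zero, so is
    every homogeneous element of [N]. Otherwise the image is everything, the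
    layers of [N] form a covering below [F], and thinness leaves no room for
    [N] to be proper. *)
Lemma dsum_graded_simple :
  simple_module M -> thin_covering gr F -> graded_simple gr (dsum_grading F).
Proof.
move=> [[v v0] Ms] [_ Ft]; split; first exact: dsum_module_grading.
  have [_ /(_ v)[x [xF xv]] _] := covP F.
  (* A nonzero vector is a sum of vectors of the subspaces [F g]; that family
     is a nonzero element of the direct sum. *)
  have xP : x \in dsum_pred F by apply/asboolP.
  exists (Dsum xP); apply: contraNneq v0 => x0.
  rewrite -xv big1// => g _.
  by rewrite -[x]/(dsum_val (Dsum xP)) x0 dsum_0E.
move=> N Ng; have [[N0 NP] Nd] := Ng.
have [N_0|NT] := Ms _ (dsum_total_image_submodule (proj1 Ng)).
  left; apply/seteqP; split=> [x Nx|_ ->//].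
  apply: dsum_ext => g; rewrite dsum_0E.
  have : (dsum_total @` N) (dsum_total (dsum_comp g x)).
    by exists (dsum_comp g x) => //; apply: graded_submodule_comp.
  rewrite N_0/= (dsum_total_homog (@dsum_comp_homog g x)).
  by rewrite dsum_compE eqxx.
right; apply/seteqP; split=> // x _.
have NF := Ft _ (dsum_layer_covering Ng NT).
have Nc g : N (dsum_comp g x).
  have : dsum_layer N g (x g).
    rewrite NF; first exact: dsumP.
    by move=> h _ [y _ <-]; apply: dsumP.
  case=> y [Ny yg] yx; suff <- : y = dsum_comp g x by [].
  apply: (dsum_homog_ext yg); first exact: dsum_comp_homog.
  by rewrite dsum_compE eqxx.
rewrite -(dsum_comp_sum x); apply: big_ind => // u w Nu Nw.
by rewrite -[u]scale1r; apply: NP.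
Qed.

End DirectSumSimple.

(** * The direct sum of a twisted covering *)

Section DirectSumTwist.
Context (R : realType) (G : finZmodType) (A : algType R[i]).
Context (gr : algebra_grading G A) (s : dual R G).
Context (M : lmodType A) (F : covering gr M).

Definition dsum_twist (x : dsum (covering_twist s F)) :
    twist gr s (dsum F) :=
  @Dsum R G A gr M F (dsum_val x) (dsum_valP x).

Definition dsum_untwist (x : twist gr s (dsum F)) :
    dsum (covering_twist s F) :=
  @Dsum R G A gr (twist gr s M) (covering_twist s F)
    (dsum_val (x : dsum F)) (dsum_valP (x : dsum F)).

(** Only the homogeneous components of a scalar act on a direct sum, and on
    the component of degree [g] both twists insert the factor [s g]: one in the
    action on entries, the other in the scalar itself. *)
Lemma dsum_twist_linear : linear dsum_twist.
Proof.
move=> a x y; apply: (@dsum_ext R G A gr M F) => k.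
rewrite [LHS]dsum_addE [RHS]dsum_addE; congr (_ + _).
rewrite [LHS]dsum_scaleE [RHS]dsum_scaleE; apply: eq_bigr => g _.
rewrite (twist_scale_homog _ (hcompP gr g a)) hcomp_dual_act.
by rewrite scalerA mulr_algl.
Qed.

End DirectSumTwist.

(** * Graded modules are isomorphic to their twists *)

Section WeightedSum.
Context (R : realType) (G : finZmodType) (A : algType R[i]).
Context (gr : algebra_grading G A) (P : lmodType A) (F : G -> set P).
Context (FP : module_grading gr F).

Definition mcomp g (p : P) : P :=
  let: And3 _ Fd _ := FP in sval (cid (Fd p)) g.

Lemma mcompP g p : F g (mcomp g p).
Proof. by rewrite /mcomp; case: FP => _ Fd _; case: cid => x /= [[]]. Qed.

Lemma mcomp_sum p : \sum_g mcomp g p = p.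
Proof. by rewrite /mcomp; case: FP => _ Fd _; case: cid => x /= [[]]. Qed.

Lemma mcomp_uniq (x : G -> P) p :
  (forall g, F g (x g)) -> \sum_g x g = p -> forall g, mcomp g p = x g.
Proof.
move=> xP xp g; rewrite /mcomp; case: FP => _ Fd _; case: cid => y /= [_ yu].
rewrite (yu [ffun h => x h]) ?ffunE//; split; first by move=> h; rewrite ffunE.
by rewrite -xp; apply: eq_bigr => h _; rewrite ffunE.
Qed.

Lemma mcomp_homog g p : F g p -> forall h, mcomp h p = if h == g then p else 0.
Proof.
move=> Fp; apply: mcomp_uniq; last by rewrite -big_mkcond big_pred1_eq.
by move=> h; case: eqP => [->//|_]; have [/(_ h)[]] := FP.
Qed.

Lemma mcompD g p q : mcomp g (p + q) = mcomp g p + mcomp g q.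
Proof.
apply: (@mcomp_uniq (fun g => mcomp g p + mcomp g q)).
  by move=> h; have [Fs _ _] := FP; apply: (subspaceD (Fs h)); apply: mcompP.
by rewrite big_split/= !mcomp_sum.
Qed.

Lemma mcompZ k (a : A) p :
  mcomp k (a *: p) = \sum_g hcomp gr g a *: mcomp (k - g) p.
Proof.
have [Fs _ FM] := FP.
apply: (@mcomp_uniq (fun k => \sum_g hcomp gr g a *: mcomp (k - g) p)).
  move=> h; apply: (subspace_sum (Fs h)) => g.
  by rewrite -{1}[h](subrKC g); apply: FM; [apply: hcompP|apply: mcompP].
rewrite exchange_big/= -[in RHS](hcomp_sum gr a) scaler_suml.
apply: eq_bigr => g _; rewrite -scaler_sumr; congr (_ *: _).
rewrite -[RHS]mcomp_sum (reindex_onto (fun h => h + g) (fun h => h - g))/=.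
  by apply: eq_big => [h|h _]; rewrite addrK// eqxx.
by move=> h _; rewrite subrK.
Qed.

Definition weighted_sum (c : G -> R[i]) (p : P) : P :=
  \sum_g (c g)%:A *: mcomp g p.

Lemma mcomp_weighted_sum c g p :
  mcomp g (weighted_sum c p) = (c g)%:A *: mcomp g p.
Proof.
apply: (@mcomp_uniq (fun g => (c g)%:A *: mcomp g p)) => // h.
by have [Fs _ _] := FP; apply: (subspace_scale _ (Fs h)); apply: mcompP.
Qed.

Lemma weighted_sum_homog c g p : F g p -> weighted_sum c p = (c g)%:A *: p.
Proof.
move=> Fp; rewrite /weighted_sum (bigD1 g)//= (mcomp_homog Fp) eqxx.
rewrite big1 ?addr0// => h hg.
by rewrite (mcomp_homog Fp) (negPf hg) scaler0.
Qed.

Lemma weighted_sumK c d :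
  (forall g, d g * c g = 1) -> cancel (weighted_sum c) (weighted_sum d).
Proof.
move=> dc p; rewrite -[RHS]mcomp_sum; apply: eq_bigr => g _.
by rewrite mcomp_weighted_sum scale_algA dc !scale1r.
Qed.

Lemma weighted_sum_image c d g :
  (forall h, d h * c h = 1) -> weighted_sum c @` F g = F g.
Proof.
have [Fs _ _] := FP => dc; apply/seteqP; split=> [_ [p Fp <-]|p Fp].
  by rewrite (weighted_sum_homog c Fp); apply: (subspace_scale _ (Fs g)).
exists (weighted_sum d p).
  by rewrite (weighted_sum_homog d Fp); apply: (subspace_scale _ (Fs g)).
by apply: weighted_sumK => h; rewrite mulrC.
Qed.

(** On degree [g] the map divides by [s g]. Moving from degree [h] to degree
    [g + h] thus costs a factor [(s g)^-1], which undoes the factor [s g] of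
    the twisted action. *)
Lemma weighted_sum_twist_linear (s : dual R G) :
  linear (weighted_sum (fun g => (s g)^-1) : twist gr s P -> P).
Proof.
move=> a p q; rewrite /weighted_sum.
have -> : a *: p + q = dual_act gr s a *: (p : P) + q :> P by [].
under eq_bigr do rewrite mcompD scalerDr.
rewrite big_split/=; congr (_ + _).
under eq_bigr do rewrite mcompZ scaler_sumr.
rewrite exchange_big/= -[in RHS](hcomp_sum gr a) scaler_suml.
apply: eq_bigr => g _; rewrite scaler_sumr.
rewrite (reindex_onto (fun h => h + g) (fun h => h - g))/=; last first.
  by move=> h _; rewrite subrK.
apply: eq_big => [h|h _]; first by rewrite addrK eqxx.
rewrite addrK hcomp_dual_act !scalerA mulr_algl mulr_algr scalerA.
by rewrite dualD invfM mulrVK// unitfE dual_neq0.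
Qed.

End WeightedSum.

Theorem proposition1p6 (R : realType) (G : finZmodType) (A : algType R[i])
    (gr : algebra_grading G A) :
  [/\ forall (M : lmodType A) (s : dual R G) (F : G -> set M),
        simple_module M ->
        thin_covering gr F -> @thin_covering R G A gr (twist gr s M) F,
      forall (M : lmodType A) (s : dual R G) (F : covering gr M),
        simple_module M ->
        thin_covering gr F ->
        let P : lmodType A := dsum (covering_twist s F) in
        let Q : lmodType A := twist gr s (dsum F) in
        let FP : G -> set P := dsum_grading (covering_twist s F) in
        let FQ : G -> set Q := dsum_grading F in
        [/\ graded_simple gr FP,
            graded_simple gr FQ
          & exists f : {linear P -> Q},
              graded_iso FP FQ f /\
              forall (x : P) (g : G), dsum_val (f x : dsum F) g = dsum_val x g]
    & forall (P : lmodType A) (FP : G -> set P),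
        module_grading gr FP ->
        forall s : dual R G,
        exists f : {linear twist gr s P -> P},
          @graded_iso R G A (twist gr s P) P FP FP f].
Proof.
split.
- by move=> M s F _; apply: thin_covering_twist.
- move=> M s F Ms Ft P Q FP FQ; split.
  + apply: dsum_graded_simple; first exact: simple_twist.
    exact: thin_covering_twist.
  + exact: (@graded_simple_twist _ _ _ _ s _ _ (dsum_graded_simple Ms Ft)).
  + pose f : {linear P -> Q} := HB.pack (@dsum_twist R G A gr s M F)
      (GRing.isLinear.Build A P Q _ _ (@dsum_twist_linear R G A gr s M F)).
    exists f; split=> //; split.
      by exists (@dsum_untwist R G A gr s M F) => x; apply: dsum_ext.
    move=> g; apply/seteqP; split=> [_ [x xg <-] //|y yg].
    by exists (dsum_untwist y) => //; apply: dsum_ext.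
- move=> P FP Pg s; pose c g := (s g)^-1.
  have sc g : s g * c g = 1 by rewrite mulfV// dual_neq0.
  pose f : {linear twist gr s P -> P} := HB.pack (weighted_sum Pg c)
    (GRing.isLinear.Build A (twist gr s P) P _ _
      (@weighted_sum_twist_linear R G A gr P FP Pg s)).
  exists f; split; last by move=> g; apply: weighted_sum_image sc.
  exists (weighted_sum Pg s); first exact: weighted_sumK.
  by apply: weighted_sumK => g; rewrite mulrC.
Qed.
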